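(* (Rotation covariance.) Let $n\equiv 2$ or $3\pmod 4$, let $\psi\in L^2(\mathbb{R}^n;Cl_n)$ be an admissible Clifford mother wavelet and let $f\in L^2(\mathbb{R}^n;Cl_n)$. Let $r_\theta,r_{\theta_0}\in SO(n)$ be rotations and let $\theta'$ be the parameter of the rotation $r_{\theta'}=r_{\theta_0}r_\theta$. Then for all $a>0$ and $b\in\mathbb{R}^n$, $$[T_\psi f(r_{\theta_0}\cdot)](a,\theta,b)=T_\psi f(a,\theta',r_{\theta_0}b) ,$$ where the left side is the Clifford wavelet transform of the function $x\mapsto f(r_{\theta_0}x)$.
   Context: $Cl_n=Cl_{n,0}$ is the real Clifford algebra of Euclidean $\mathbb{R}^n$ with orthonormal vectors $e_1,\dots,e_n$ and basis blades $e_A$; $M=\sum_AM_Ae_A$, $|M|^2=\sum_AM_A^2$. The reverse is $\widetilde M=\sum_k(-1)^{k(k-1)/2}\langle M\rangle_k$ (also written $\{M\}^\sim$), $\langle M\rangle_k$ being the grade-$k$ part. $L^2(\mathbb{R}^n;Cl_n)$ is the space of $f:\mathbb{R}^n\to Cl_n$ with $\int|f|^2<\infty$. $i_n=e_1\cdots e_n$, $i_n^2=-1$ for $n\equiv 2,3\pmod 4$. Clifford Fourier transform: $\widehat f(\omega)=\int_{\mathbb{R}^n}f(x)e^{-i_n\omega\cdot x}d^nx$ (extended to $L^2$). Daughter wavelets, for $a>0$, $r_\theta\in SO(n)$ (parametrized by $\theta$; dependence on $\theta$ is only through $r_\theta$), $b\in\mathbb{R}^n$: $\psi_{a,\theta,b}(x)=a^{-n/2}\psi\bigl(r_\theta^{-1}((x-b)/a)\bigr)$.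 Admissibility: $\psi\in L^2(\mathbb{R}^n;Cl_n)$ is admissible if $C_\psi=\int_{\mathbb{R}^+}\int_{SO(n)}a^n\{\widehat\psi(a r_\theta^{-1}(\omega))\}^{\sim}\,\widehat\psi(a r_\theta^{-1}(\omega))\,a^{-(n+1)}da\,d\theta$ ($d\theta$ the normalized Haar measure on $SO(n)$) is, for a.e. $\omega$, a finite invertible multivector constant. In addition, for $n\equiv2\pmod4$, $\psi$ is required to have only even-grade or only odd-grade values. Clifford wavelet transform: $T_\psi f(a,\theta,b)=\int_{\mathbb{R}^n}f(x)\widetilde{\psi_{a,\theta,b}(x)}\,d^nx$. *)

(* Defs.v *)
From HB Require Import structures.
From mathcomp Require Import all_boot all_order all_algebra.
From mathcomp Require Import ring.
From mathcomp Require Import all_classical all_reals all_analysis.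

Set Implicit Arguments.
Unset Strict Implicit.
Unset Printing Implicit Defensive.

Import Order.TTheory GRing.Theory Num.Theory.
Import numFieldNormedType.Exports.

Local Open Scope classical_set_scope.
Local Open Scope ring_scope.

(* Elements of Cl_{n,0}: a multivector is the family of its coefficients M_A on
   the basis blades e_A, A a subset of the index set.  The alias hides the
   pointwise product of finite functions. *)
Definition Cl (R : realType) (n : nat) : Type := {ffun {set 'I_n} -> R^o}.

HB.instance Definition _ (R : realType) (n : nat) :=
  GRing.Lmodule.on (Cl R n).

Definition symdiff (n : nat) (A B : {set 'I_n}) : {set 'I_n} :=
  [set i | (i \in A) (+) (i \in B)]%SET.

(* Sorting the concatenated word e_A e_B costs one sign for every pair i in A,
   j in B with j < i; repeated generators then cancel because e_i^2 = 1. *)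
Definition cl_sign (R : realType) (n : nat) (A B : {set 'I_n}) : R :=
  (-1) ^+ (\sum_(i in A) \sum_(j in B) (j < i)%N)%N.

Definition blade (R : realType) (n : nat) (A : {set 'I_n}) : Cl R n :=
  [ffun B => (B == A)%:R].

Definition cl_mul (R : realType) (n : nat) (M N : Cl R n) : Cl R n :=
  \sum_(A : {set 'I_n}) \sum_(B : {set 'I_n})
     (cl_sign R A B * M A * N B) *: blade R (symdiff A B).

Section cl_ring.
Variables (R : realType) (n : nat).
Implicit Types (A B C D : {set 'I_n}) (M N P : Cl R n).

Let sdC A B : symdiff A B = symdiff B A.
Proof. by apply/setP => i; rewrite !inE addbC. Qed.

Let sdA A B C : symdiff A (symdiff B C) = symdiff (symdiff A B) C.
Proof. by apply/setP => i; rewrite !inE addbA. Qed.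

Let sdK A B : symdiff A (symdiff A B) = B.
Proof. by apply/setP => i; rewrite !inE addbA addbb. Qed.

Let sd0 A : symdiff finset.set0 A = A.
Proof. by apply/setP => i; rewrite !inE. Qed.

Let signE A B : cl_sign R A B =
  \prod_i \prod_j (if (i \in A) && (j \in B) then (-1) ^+ (j < i)%N else 1).
Proof.
rewrite /cl_sign expr_sum big_mkcond; apply: eq_bigr => i _.
case: (i \in A) => /=; last by rewrite big1.
by rewrite expr_sum big_mkcond.
Qed.

Let signDl A B C : cl_sign R (symdiff A B) C = cl_sign R A C * cl_sign R B C.
Proof.
rewrite !signE -big_split; apply: eq_bigr => i _ /=.
rewrite -big_split; apply: eq_bigr => j _ /=; rewrite !inE.
case: (i \in A); case: (i \in B); case: (j \in C) => //=;
  rewrite ?mulr1 ?mul1r //.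
by case: (j < i)%N; rewrite ?expr1 ?expr0 ?mulrNN ?mulr1.
Qed.

Let signDr A B C : cl_sign R C (symdiff A B) = cl_sign R C A * cl_sign R C B.
Proof.
rewrite !signE -big_split; apply: eq_bigr => i _ /=.
rewrite -big_split; apply: eq_bigr => j _ /=; rewrite !inE.
case: (j \in A); case: (j \in B); case: (i \in C) => //=;
  rewrite ?mulr1 ?mul1r //.
by case: (j < i)%N; rewrite ?expr1 ?expr0 ?mulrNN ?mulr1.
Qed.

Let sign0l A : cl_sign R finset.set0 A = 1.
Proof. by rewrite /cl_sign big_set0. Qed.

Let sign0r A : cl_sign R A finset.set0 = 1.
Proof. by rewrite /cl_sign big1 // => i _; rewrite big_set0. Qed.

Lemma cl_mulE M N C : cl_mul M N C =
  \sum_A cl_sign R A (symdiff A C) * M A * N (symdiff A C).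
Proof.
rewrite sum_ffunE; apply: eq_bigr => A _; rewrite sum_ffunE.
rewrite (bigD1 (symdiff A C)) //= big1 => [|B neB].
  by rewrite addr0 !ffunE sdK eqxx; exact: mulr1.
rewrite !ffunE; case: eqP => [eqC|_]; last by rewrite scaler0.
by rewrite eqC sdK eqxx in neB.
Qed.

Fact cl_mulA : associative (@cl_mul R n).
Proof.
move=> M N P; apply/ffunP => C; rewrite !cl_mulE.
under eq_bigr do rewrite cl_mulE mulr_sumr.
under [RHS]eq_bigr do rewrite cl_mulE mulr_sumr mulr_suml.
rewrite [RHS]exchange_big /=; apply: eq_bigr => A _.
rewrite (reindex_inj (h := symdiff A)) /=; last first.
  by move=> D E /(congr1 (symdiff A)); rewrite !sdK.
apply: eq_bigr => D _.
have -> : symdiff (symdiff A D) (symdiff A C) = symdiff D C.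
  by rewrite -sdA (sdA D) (sdC D) -sdA sdK.
have sgn : cl_sign R A (symdiff A C) * cl_sign R (symdiff A D) (symdiff D C) =
          cl_sign R D (symdiff D C) * cl_sign R A (symdiff A D).
  rewrite signDl !signDr.
  have : cl_sign R A C * cl_sign R A C = 1.
    by rewrite /cl_sign -expr2 sqrr_sign.
  move: (cl_sign R A C) => s sq1; rewrite -[RHS]mul1r -sq1; ring.
rewrite !mulrA -(mulrA (cl_sign R A _)) (mulrC (M A)) mulrA sgn.
by rewrite -(mulrA _ _ (M A)) -!mulrA; congr (_ * _); rewrite !mulrA.
Qed.

Fact cl_mul1l : left_id (blade R finset.set0) (@cl_mul R n).
Proof.
move=> M; apply/ffunP => C; rewrite cl_mulE (bigD1 finset.set0) //= big1.
  by rewrite addr0 sd0 sign0l ffunE eqxx !mul1r.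
by move=> A /negPf neA; rewrite ffunE neA mulr0 mul0r.
Qed.

Fact cl_mul1r : right_id (blade R finset.set0) (@cl_mul R n).
Proof.
move=> M; apply/ffunP => C; rewrite cl_mulE (bigD1 C) //= big1.
  have -> : symdiff C C = finset.set0.
    by apply/setP => i; rewrite !inE addbb.
  by rewrite addr0 sign0r ffunE eqxx mul1r; exact: mulr1.
move=> A neA; rewrite ffunE; case: eqP => [AC|_]; last exact: mulr0.
by move: neA; rewrite -(sdK A C) AC sdC sd0 eqxx.
Qed.

Fact cl_mulDl : left_distributive (@cl_mul R n) +%R.
Proof.
move=> M N P; apply/ffunP => C; rewrite [RHS]ffunE !cl_mulE -big_split /=.
by apply: eq_bigr => A _; rewrite ffunE mulrDr mulrDl.
Qed.

Fact cl_mulDr : right_distributive (@cl_mul R n) +%R.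
Proof.
move=> M N P; apply/ffunP => C; rewrite [RHS]ffunE !cl_mulE -big_split /=.
by apply: eq_bigr => A _; rewrite ffunE mulrDr.
Qed.

Fact cl_oner_neq0 : blade R finset.set0 != 0 :> Cl R n.
Proof.
apply/eqP => /ffunP/(_ finset.set0)/eqP.
by rewrite !ffunE eqxx oner_eq0.
Qed.

HB.instance Definition _ := GRing.Zmodule_isNzRing.Build (Cl R n)
  cl_mulA cl_mul1l cl_mul1r cl_mulDl cl_mulDr cl_oner_neq0.

Fact cl_scalerAl (t : R) M N : t *: (M * N) = t *: M * N.
Proof.
apply/ffunP => C; rewrite ffunE !cl_mulE scaler_sumr.
apply: eq_bigr => A _; rewrite ffunE -!mulrA.
exact: (mulrCA t (cl_sign R A _) (M A * N _)).
Qed.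

HB.instance Definition _ := GRing.Lmodule_isLalgebra.Build R (Cl R n)
  cl_scalerAl.

Fact cl_scalerAr (t : R) M N : t *: (M * N) = M * (t *: N).
Proof.
apply/ffunP => C; rewrite ffunE !cl_mulE scaler_sumr.
apply: eq_bigr => A _; rewrite ffunE.
exact: (mulrCA t (cl_sign R A _ * M A) (N _)).
Qed.

HB.instance Definition _ := GRing.Lalgebra_isAlgebra.Build R (Cl R n)
  cl_scalerAr.

Definition cl_gen (i : 'I_n) : Cl R n := blade R [set i]%SET.

Lemma blade_mul A B :
  blade R A * blade R B = cl_sign R A B *: blade R (symdiff A B).
Proof.
apply/ffunP => C; rewrite cl_mulE (bigD1 A) //= big1 ?addr0 => [|D /negPf neD].
  rewrite !ffunE eqxx mulr1; case: eqP => [<-|ne]; first by rewrite sdK eqxx.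
  by case: eqP => [eC|_]; [case: ne; rewrite eC sdK|rewrite mulr0 scaler0].
by rewrite ffunE neD mulr0 mul0r.
Qed.

(* The defining relations of Cl_{n,0}. *)
Lemma cl_gen_anticomm (i j : 'I_n) :
  cl_gen i * cl_gen j + cl_gen j * cl_gen i = ((i == j)%:R *+ 2)%:A.
Proof.
rewrite !blade_mul /cl_sign !big_set1 (sdC [set j]%SET).
have [<-|neij] := eqVneq i j.
  rewrite ltnn expr0 -scalerDl -mulr2n; congr (_ *: blade R _).
  by apply/setP => k; rewrite !inE addbb.
rewrite -scalerDl mul0rn scale0r.
case: ltngtP => [_|_|/val_inj eij]; last by rewrite eij eqxx in neij.
  by rewrite expr0 expr1 addrC subrr scale0r.
by rewrite expr0 expr1 subrr scale0r.
Qed.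

End cl_ring.

Arguments cl_gen : clear implicits.

Definition cl_invertible (R : realType) (n : nat) (C : Cl R n) : Prop :=
  exists D : Cl R n, C * D = 1 /\ D * C = 1.

Definition cl_normsq (R : realType) (n : nat) (M : Cl R n) : R :=
  \sum_(A : {set 'I_n}) M A ^+ 2.

Definition cl_rev (R : realType) (n : nat) (M : Cl R n) : Cl R n :=
  [ffun A : {set 'I_n} => (-1) ^+ (#|A| * #|A|.-1)./2 * M A].

(* i_n = e_1 ... e_n, 0-based here. *)
Definition pseudoscalar (R : realType) (n : nat) : Cl R n :=
  \prod_(i < n) cl_gen R n i.

Definition cl_exp (R : realType) (n : nat) (M : Cl R n) : Cl R n :=
  [ffun A : {set 'I_n} =>
     limn (series (fun k => (M ^+ k) A / k`!%:R : R^o))].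

Definition mx_display : measure_display -> measure_display.
Proof. exact. Qed.

Section measurable_matrix.
Context {d : measure_display} {T : measurableType d}.
Variables m n : nat.

Definition mx_coord_sets : set (set 'M[T]_(m, n)) :=
  [set B | exists i j (A : set T),
     measurable A /\ B = (fun M : 'M[T]_(m, n) => M i j) @^-1` A].

Let mx_set0 : <<s mx_coord_sets >> set0.
Proof. exact: sigma_algebra0. Qed.

Let mx_setC A : <<s mx_coord_sets >> A -> <<s mx_coord_sets >> (~` A).
Proof. exact: sigma_algebraC. Qed.

Let mx_bigcup (F : (set 'M[T]_(m, n))^nat) :
  (forall i, <<s mx_coord_sets >> (F i)) ->
  <<s mx_coord_sets >> (\bigcup_i F i).
Proof. exact: sigma_algebra_bigcup. Qed.

(* The product sigma-algebra; for real entries these are the Borel sets. *)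
HB.instance Definition _ := @isMeasurable.Build (mx_display d)
  'M[T]_(m, n) <<s mx_coord_sets >> mx_set0 mx_setC mx_bigcup.

End measurable_matrix.

Lemma measurable_mx (d d' : measure_display) (T : measurableType d)
    (U : measurableType d') (m n : nat) (f : U -> 'M[T]_(m, n)) :
  (forall i j, measurable_fun [set: U] (fun x => f x i j)) ->
  measurable_fun [set: U] f.
Proof.
move=> mf; apply: (@measurability _ _ _ _ _ _ (@mx_coord_sets d T m n)) => //.
by move=> _ [_ [i [j [A [mA ->]]]] <-]; exact: mf.
Qed.

Lemma measurable_entry (d : measure_display) (T : measurableType d)
    (m n : nat) (i : 'I_m) (j : 'I_n) :
  measurable_fun [set: 'M[T]_(m, n)] (fun M => M i j).
Proof.
move=> _ A mA; rewrite setTI.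
by apply: sub_sigma_algebra; exists i, j, A.
Qed.

Section lebesgue_measure_step.
Variables (R : realType) (n : nat).

Definition cv_cons (p : measurableTypeR R * 'cV[R]_n) : 'cV[R]_n.+1 :=
  \col_i if unlift ord0 i is Some k then p.2 k ord0 else p.1.

Lemma measurable_cv_cons : measurable_fun [set: _] cv_cons.
Proof.
apply: measurable_mx => i j; case Ei: (unlift ord0 i) => [k|].
  rewrite [X in measurable_fun _ X](_ : _ = (fun v : 'cV[R]_n => v k ord0) \o snd).
    by apply: measurableT_comp => //; exact: measurable_entry.
  by apply/funext => p; rewrite mxE Ei.
rewrite [X in measurable_fun _ X](_ : _ = fst) //.
by apply/funext => p; rewrite mxE Ei.
Qed.

Variable mu : {sigma_finite_measure set 'cV[R]_n -> \bar R}.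

Definition lebesgue_step : set 'cV[R]_n.+1 -> \bar R :=
  pushforward (lebesgue_measure \x mu)%E cv_cons.

HB.instance Definition _ := Measure.copy lebesgue_step
  (measure_function_pushforward__canonical__measure_function_Measure
     (lebesgue_measure \x mu)%E measurable_cv_cons).

Let step_sigma_finite : sigma_finite setT lebesgue_step.
Proof.
have [F FT Foo] : sigma_finite setT (lebesgue_measure \x mu)%E.
  have /sigma_finiteP[F [FT ndF Foo]] := sigma_finiteT (@lebesgue_measure R).
  have /sigma_finiteP[G [GT ndG Goo]] := sigma_finiteT mu.
  exists (fun k => F k `*` G k).
    rewrite -setXTT FT GT predeqE => -[x y]; split.
      move=> [/= [k _ Fkx] [l _ Gly]]; exists (maxn k l) => //; split.
      - by move: x Fkx; exact/subsetPset/ndF/leq_maxl.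
      - by move: y Gly; exact/subsetPset/ndG/leq_maxr.
    by move=> [k _ []/= ? ?]; split; exists k.
  move=> k; have [mF Fk] := Foo k; have [mG Gk] := Goo k.
  split; first exact: measurableX.
  by rewrite product_measure1E// lte_mul_pinfty// ge0_fin_numE.
pose uncons (v : 'cV[R]_n.+1) : measurableTypeR R * 'cV[R]_n :=
  (v ord0 ord0, \col_k v (lift ord0 k) ord0).
have munc : measurable_fun setT uncons.
  apply/measurable_fun_pair => /=; first exact: measurable_entry.
  apply: measurable_mx => i j.
  rewrite [X in measurable_fun _ X](_ : _ =
    fun v : 'cV[R]_n.+1 => v (lift ord0 i) ord0); first exact: measurable_entry.
  by apply/funext => v; rewrite mxE.
have consK : cancel cv_cons uncons.
  move=> [x v]; rewrite /uncons /cv_cons mxE unlift_none /=; congr pair.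
  by apply/colP => k; rewrite !mxE liftK.
exists (fun k => uncons @^-1` F k); first by rewrite -preimage_bigcup -FT.
move=> k; have [mF ltF] := Foo k; split.
  by rewrite -[X in measurable X]setTI; exact: munc.
rewrite /lebesgue_step /pushforward -comp_preimage.
by rewrite (_ : uncons \o cv_cons = id) //; apply/funext => p; exact: consK.
Qed.

HB.instance Definition _ :=
  @Measure_isSigmaFinite.Build _ _ _ lebesgue_step step_sigma_finite.

End lebesgue_measure_step.

(* Lebesgue measure on R^n, as the n-fold product of the one on R. *)
Fixpoint lebesgue_cv (R : realType) (n : nat) :
    {sigma_finite_measure set 'cV[R]_n -> \bar R} :=
  if n is m.+1 then lebesgue_step (lebesgue_cv R m) else dirac (0 : 'cV[R]_0).

Section clifford_functions.
Variables (R : realType) (n : nat).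
Local Notation vec := 'cV[R]_n.
Local Notation leb := (lebesgue_cv R n).
Implicit Types f g psi : vec -> Cl R n.

(* Measurability for the completion of Lebesgue measure: agreement almost
   everywhere with a Borel function.  The library integral, a supremum over
   Borel simple functions, is the Lebesgue integral for such functions too. *)
Definition lebesgue_measurable (h : vec -> R) : Prop :=
  exists2 k : vec -> R,
    measurable_fun [set: vec] k & {ae leb, forall x, h x = k x}.

Definition cl_measurable f : Prop :=
  forall A : {set 'I_n}, lebesgue_measurable (fun x => f x A).

Definition is_L1 f : Prop :=
  cl_measurable f /\
  (\int[leb]_x (Num.sqrt (cl_normsq (f x)))%:E < +oo)%E.

Definition is_L2 f : Prop :=
  cl_measurable f /\ (\int[leb]_x (cl_normsq (f x))%:E < +oo)%E.

Definition cvg_L2 (u : (vec -> Cl R n)^nat) f : Prop :=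
  (fun k => \int[leb]_x (cl_normsq (u k x - f x))%:E)%E @ \oo --> 0%E.

Definition cl_integral (d : measure_display) (T : measurableType d)
    (mu : {measure set T -> \bar R}) (D : set T) (F : T -> Cl R n) : Cl R n :=
  [ffun A : {set 'I_n} => Rintegral mu D (fun x => F x A)].

Definition cl_integrable (d : measure_display) (T : measurableType d)
    (mu : {measure set T -> \bar R}) (D : set T) (F : T -> Cl R n) : Prop :=
  forall A : {set 'I_n}, mu.-integrable D (fun x => (F x A)%:E).

Definition dotv (w x : vec) : R := \sum_i w i ord0 * x i ord0.

Definition cft_L1 f (w : vec) : Cl R n :=
  cl_integral leb setT
    (fun x => f x * cl_exp (- (dotv w x *: pseudoscalar R n))).

(* [g] represents the Fourier transform of the L^2 function [f]: the extension
   by continuity from L^1 /\ L^2, defined up to null sets. *)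
Definition is_cft f g : Prop :=
  is_L2 f /\ is_L2 g /\
  exists u : (vec -> Cl R n)^nat,
    (forall k, is_L1 (u k) /\ is_L2 (u k)) /\
    cvg_L2 u f /\ cvg_L2 (fun k => cft_L1 (u k)) g.

Definition SO : set 'M[R]_n := [set r | r^T *m r = 1%:M /\ \det r = 1].

(* Normalized Haar measure of SO(n), seen as a Borel measure on matrices
   carried by SO(n). *)
Definition is_haar_SO (haar : probability 'M[R]_n R) : Prop :=
  haar SO = 1%E /\
  forall (r : 'M[R]_n) (B : set 'M[R]_n), SO r -> measurable B ->
    haar ((fun s => r *m s) @^-1` B) = haar B.

Definition daughter psi (a : R) (r : 'M[R]_n) (b x : vec) : Cl R n :=
  (a `^ (- (n%:R / 2))) *: psi (invmx r *m (a^-1 *: (x - b))).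

Definition admissibility_integrand (psihat : vec -> Cl R n) (w : vec)
    (p : measurableTypeR R * 'M[R]_n) : Cl R n :=
  let: (a, r) := p in
  let M := psihat (a *: (invmx r *m w)) in
  (a ^+ n * a ^- n.+1) *: (cl_rev M * M).

Definition even_valued psi : Prop :=
  {ae leb, forall x, forall A : {set 'I_n}, odd #|A| -> psi x A = 0}.

Definition odd_valued psi : Prop :=
  {ae leb, forall x, forall A : {set 'I_n}, ~~ odd #|A| -> psi x A = 0}.

(* The Fourier transform is an L^2 class.  C_psi does not depend on its
   representative, but [integrable] asks for a Borel one, whence the [exists]. *)
Definition admissible (haar : probability 'M[R]_n R) psi : Prop :=
  is_L2 psi /\
  (exists psihat, is_cft psi psihat /\
   exists C : Cl R n, cl_invertible C /\
     {ae leb, forall w,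
        cl_integrable (lebesgue_measure \x haar)%E (`]0, +oo[ `*` SO)
          (admissibility_integrand psihat w) /\
        cl_integral (lebesgue_measure \x haar)%E (`]0, +oo[ `*` SO)
          (admissibility_integrand psihat w) = C}) /\
  ((n %% 4 = 2)%N -> even_valued psi \/ odd_valued psi).

Definition wavelet_transform psi f (a : R) (r : 'M[R]_n) (b : vec) : Cl R n :=
  cl_integral leb setT (fun x => f x * cl_rev (daughter psi a r b x)).

End clifford_functions.

Arguments SO {R n}.

(* Main.v *)
(* Substituting y = r0 x turns one integrand into the other, so everything rests
   on the invariance of Lebesgue measure under an orthogonal matrix g.  The image
   of Lebesgue measure under g is translation invariant, hence a multiple of
   Lebesgue measure, and the factor is 1 because g preserves the unit ball, whose
   measure is positive and finite. *)

From HB Require Import structures.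
Require Import Defs.
From mathcomp Require Import all_boot all_order all_algebra.
From mathcomp Require Import all_classical all_reals all_analysis measurable_realfun.

Set Implicit Arguments.
Unset Strict Implicit.
Unset Printing Implicit Defensive.

Import Order.TTheory GRing.Theory Num.Theory.
Local Open Scope ring_scope.
Local Open Scope classical_set_scope.

(** * Change of variables under a measure-preserving bijection *)

Section measure_preserving_bijection.
Context d (T : measurableType d) (R : realType).
Variable mu : {measure set T -> \bar R}.
Import HBNNSimple.
Local Open Scope ereal_scope.

(** Each simple [h] below [f] yields the simple function [h \o phi] below [f \o phi]; its level sets
    are preimages under [phi], so its integral is that of [h]. *)
Lemma ge0_le_integral_comp (phi : T -> T) (f : T -> \bar R) :
  measurable_fun setT phi ->
  (forall A, measurable A -> mu (phi @^-1` A) = mu A) ->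
  (forall x, 0 <= f x) -> \int[mu]_x f x <= \int[mu]_x f (phi x).
Proof.
move=> mphi mu_phi f0.
rewrite !ge0_integralTE//; apply: ge_ereal_sup => _ [h /= hf <-].
have mhphi : measurable_fun setT (h \o phi) by exact: measurableT_comp.
have fin : finite_set (range (h \o phi)).
  by apply: sub_finite_set (fimfunP h) => _ [x _ <-]; exists (phi x).
have ge0 x : (0 <= (h \o phi) x)%R by exact: fun_ge0.
pose k := HB.pack_for {nnsfun T >-> R} (h \o phi)
  (isMeasurableFun.Build _ _ _ _ _ mhphi) (FiniteImage.Build _ _ _ fin)
  (isNonNegFun.Build _ _ _ ge0).
apply: ereal_sup_ubound; exists k => [x|]; first exact: hf.
rewrite /sintegral; apply: eq_fsbigr => x _; congr (_ * _).
by rewrite (_ : _ @^-1` _ = phi @^-1` (h @^-1` [set x])) // mu_phi.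
Qed.

(* The library integral is a supremum over simple functions, and these correspond
   through [phi], even when [f] itself is not Borel. *)
Lemma integral_comp_bijection (phi phi' : T -> T) (f : T -> \bar R) :
  cancel phi' phi ->
  measurable_fun setT phi -> measurable_fun setT phi' ->
  (forall A, measurable A -> mu (phi @^-1` A) = mu A) ->
  (forall A, measurable A -> mu (phi' @^-1` A) = mu A) ->
  \int[mu]_x f (phi x) = \int[mu]_x f x.
Proof.
move=> phiK mphi mphi' mu_phi mu_phi'.
have ge0_eq (g : T -> \bar R) : (forall x, 0 <= g x) ->
    \int[mu]_x g (phi x) = \int[mu]_x g x.
  move=> g0; apply/eqP; rewrite eq_le ge0_le_integral_comp // andbT.
  (* The converse inequality comes from [phi'] acting on [g \o phi], since [phi \o phi'] is the
     identity. *)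
  have := @ge0_le_integral_comp phi' (g \o phi) mphi' mu_phi' (fun x => g0 _).
  by under [leRHS]eq_integral do rewrite /= phiK.
rewrite integralE [RHS]integralE funepos_comp funeneg_comp.
by rewrite (ge0_eq (f ^\+)) // (ge0_eq (f ^\-)).
Qed.

End measure_preserving_bijection.

(** * Translation invariance of Lebesgue measure *)

Section lebesgue_cv_translation.
Variable R : realType.

Lemma measurable_addr (t : R) :
  measurable_fun (U := measurableTypeR R) setT
    (fun x : measurableTypeR R => x + t).
Proof. by apply: measurable_funD => //; exact: measurable_cst. Qed.

(** A measure with the Lebesgue value on every interval []u, v]] is Lebesgue measure, and
    translation preserves lengths. *)
Lemma lebesgue_measure_translation (t : R) (A : set (measurableTypeR R)) :
  measurable A ->
  lebesgue_measure ((fun x : measurableTypeR R => x + t) @^-1` A) =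
  lebesgue_measure A.
Proof.
pose mu' := measure_function_pushforward__canonical__measure_function_Measure
  (@lebesgue_measure R) (measurable_addr t).
move=> mA; symmetry.
apply: (lebesgue_measure_unique (mu := mu')) mA => _ [[u v] _ <-] /=.
rewrite /pushforward (_ : _ @^-1` _ = `]u - t, v - t]%classic); last first.
  by apply/seteqP; split=> x /=; rewrite !in_itv /= ltrBlDr lerBrDr.
by rewrite !lebesgue_measure_itv /= !lte_fin ltrD2r -!EFinB opprB addrA subrK.
Qed.

Lemma measurable_addmx m n d (U : measurableType d) (f g : U -> 'M[R]_(m, n)) :
  measurable_fun setT f -> measurable_fun setT g ->
  measurable_fun setT (fun x => f x + g x).
Proof.
move=> mf mg; apply: measurable_mx => i j.
rewrite (_ : (fun x => _) = (fun x => f x i j + g x i j)); last first.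
  by apply/funext => x; rewrite mxE.
by apply: measurable_funD; apply: (measurableT_comp (measurable_entry i j)).
Qed.

Lemma measurable_mulmx m n p d (U : measurableType d) (r : 'M[R]_(m, n))
    (f : U -> 'M[R]_(n, p)) :
  measurable_fun setT f -> measurable_fun setT (fun x => r *m f x).
Proof.
move=> mf; apply: measurable_mx => i j.
rewrite (_ : (fun x => _) = (fun x => \sum_k r i k * f x k j)); last first.
  by apply/funext => x; rewrite mxE.
apply: measurable_sum => k; apply: measurable_funM; first exact: measurable_cst.
exact: (measurableT_comp (measurable_entry k j)).
Qed.

Lemma lebesgue_cvSE n (A : set 'cV[R]_n.+1) :
  lebesgue_cv R n.+1 A =
  (lebesgue_measure \x lebesgue_cv R n)%E (@cv_cons R n @^-1` A).
Proof. by []. Qed.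

Lemma measurable_addcv n (v : 'cV[R]_n) :
  measurable_fun setT (fun x : 'cV[R]_n => x + v).
Proof. by apply: measurable_addmx => //; exact: measurable_cst. Qed.

(** Induction on the dimension: through [cv_cons] a translation acts separately on the first
    coordinate and on the rest, so uniqueness of the product measure leaves only rectangles to
    check. *)
Lemma lebesgue_cv_translation n (v : 'cV[R]_n) (A : set 'cV[R]_n) :
  measurable A ->
  lebesgue_cv R n ((fun x => x + v) @^-1` A) = lebesgue_cv R n A.
Proof.
elim: n v A => [|n IHn] v A mA.
  (* In dimension 0 there is a single vector, so the translation is the identity. *)
  by congr (lebesgue_cv R 0 _); apply/funext => x /=; rewrite [x + v]flatmx0 [x]flatmx0.
pose u : 'cV[R]_n := \col_k v (lift ord0 k) ord0.
pose s (p : measurableTypeR R * 'cV[R]_n) : measurableTypeR R * 'cV[R]_n :=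
  (p.1 + v ord0 ord0, p.2 + u).
have ms : measurable_fun setT s.
  apply/measurable_fun_pair => /=.
    by apply: (measurableT_comp (measurable_addr _)).
  exact: (measurableT_comp (measurable_addcv u)).
have mcA : measurable (@cv_cons R n @^-1` A).
  by rewrite -[X in measurable X]setTI; exact: measurable_cv_cons.
have sE : (fun x => x + v) \o @cv_cons R n = @cv_cons R n \o s.
  apply/funext => p; apply/colP => i; rewrite !mxE.
  by case: unliftP => [k|] ->; rewrite ?mxE.
rewrite !lebesgue_cvSE -comp_preimage sE comp_preimage.
pose mu' := measure_function_pushforward__canonical__measure_function_Measure
  (lebesgue_measure \x lebesgue_cv R n)%E ms.
symmetry; apply: (product_measure_unique (m' := mu')) mcA => B C mB mC.
rewrite /= /pushforward.
rewrite (_ : _ @^-1` _ = ((fun x => x + v ord0 ord0) @^-1` B) `*`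
                        ((fun x => x + u) @^-1` C)) //.
rewrite product_measure1E ?IHn //.
- by congr (_ * _)%E; exact: lebesgue_measure_translation.
- rewrite -[X in measurable X]setTI.
  exact: measurable_addr.
- rewrite -[X in measurable X]setTI.
  exact: measurable_addcv.
Qed.

End lebesgue_cv_translation.

(** * The Euclidean unit ball and its measure *)

Section unit_ball.
Variables (R : realType) (n : nat).
Local Notation vec := 'cV[R]_n.

Definition unit_ball : set vec := [set x | (x^T *m x) ord0 ord0 <= 1].

Lemma trmx_mul_colE (x : vec) :
  (x^T *m x) ord0 ord0 = \sum_i x i ord0 ^+ 2.
Proof. by rewrite mxE; apply: eq_bigr => i _; rewrite mxE. Qed.

Lemma measurable_unit_ball : measurable unit_ball.
Proof.
have mq : measurable_fun setT (fun x : vec => (x^T *m x) ord0 ord0).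
  rewrite (_ : (fun x => _) = (fun x : vec => \sum_i x i ord0 ^+ 2)).
    apply: measurable_sum => i; apply: measurable_funX.
    exact: measurable_entry.
  by apply/funext => x; rewrite trmx_mul_colE.
rewrite -[unit_ball]setTI (_ : unit_ball =
  (fun x : vec => (x^T *m x) ord0 ord0) @^-1` `]-oo, 1]%classic).
  exact: mq.
by apply/seteqP; split => x; rewrite /= in_itv.
Qed.

End unit_ball.

Section cube.
Variable R : realType.

(** Cubes are products of intervals, so their measure is explicit; two of them bracket the unit
    ball. *)
Definition cube n (c : R) : set 'cV[R]_n := [set x | forall i, `|x i ord0| <= c].
Arguments cube n c : clear implicits.

Lemma measurable_cube n (c : R) : measurable (cube n c).
Proof.
rewrite (_ : cube n c = \bigcap_(i in [set: 'I_n])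
    ((fun x : 'cV[R]_n => x i ord0) @^-1` `[- c, c]%classic)); last first.
  apply/seteqP; split => [x cx i _|x cx i] /=; first by rewrite in_itv /= -ler_norml.
  by have := cx i I; rewrite /= in_itv /= -ler_norml.
apply: fin_bigcap_measurable => // i _.
by rewrite -[X in measurable X]setTI; exact: measurable_entry.
Qed.

Lemma lebesgue_cv_cube n (c : R) : 0 <= c ->
  lebesgue_cv R n (cube n c) = ((2 * c) ^+ n)%:E.
Proof.
move=> c0; have itv_c : lebesgue_measure `[- c, c]%classic = (2 * c)%:E.
  rewrite lebesgue_measure_itv /= lte_fin -EFinB opprK -mulr2n mulr_natl.
  (* The interval formula branches on [- c < c]; the remaining branch forces [c = 0], where both
     sides vanish. *)
  case: ltP => // cN; congr EFin; apply/esym/eqP.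
  rewrite mulrn_eq0 /= eq_le c0 andbT.
  by rewrite (le_trans cN) // oppr_le0.
elim: n => [|n IHn].
  by rewrite /= diracE mem_set ?expr0 // => -[].
rewrite lebesgue_cvSE (_ : _ @^-1` _ = `[- c, c]%classic `*` cube n c).
  rewrite product_measure1E //; last exact: measurable_cube.
  rewrite IHn exprS EFinM; congr (_ * _)%E.
  exact: itv_c.
apply/seteqP; split => -[x w] /=.
  move=> cw; split=> [|i].
    by rewrite in_itv /= -ler_norml; have := cw ord0; rewrite mxE unlift_none.
  by have := cw (lift ord0 i); rewrite mxE liftK.
rewrite in_itv /= -ler_norml => -[cx cw] i; rewrite mxE.
by case: unliftP => [k|] _ //; exact: cw.
Qed.

Lemma lebesgue_cv_unit_ball n :
  (0 < lebesgue_cv R n (@unit_ball R n) < +oo)%E.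
Proof.
apply/andP; split.
  (* With coordinates at most [1/(n+1)] in absolute value, the squares sum to at most [n/(n+1)]; the
     successor also covers [n = 0]. *)
  apply: (@lt_le_trans _ _ (lebesgue_cv R n (cube n n.+1%:R^-1))).
    by rewrite lebesgue_cv_cube ?invr_ge0 // lte_fin exprn_gt0 // mulr_gt0 ?invr_gt0.
  apply: le_measure; rewrite ?inE; [exact: measurable_cube|exact: measurable_unit_ball|].
  move=> x cx; rewrite /unit_ball /= trmx_mul_colE.
  apply: (@le_trans _ _ (\sum_(i < n) n.+1%:R^-1)).
    apply: ler_sum => i _; rewrite -real_normK ?num_real // expr2.
    apply: (@le_trans _ _ (n.+1%:R^-1 * 1)); last by rewrite mulr1.
    apply: ler_pM => //; apply: le_trans (cx i) _.
    by rewrite invf_le1 ?ltr0n // ler1n.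
  rewrite sumr_const card_ord -[_ *+ n]mulr_natl ler_pdivrMr ?ltr0n //.
  by rewrite mul1r ler_nat.
apply: (@le_lt_trans _ _ (lebesgue_cv R n (cube n 1))); last first.
  by rewrite lebesgue_cv_cube // ltry.
apply: le_measure; rewrite ?inE; [exact: measurable_unit_ball|exact: measurable_cube|].
move=> x; rewrite /unit_ball /= trmx_mul_colE => x1 i.
rewrite -(@ler_pXn2r _ 2) ?nnegrE // expr1n real_normK ?num_real //.
apply: le_trans x1; rewrite (bigD1 i) //= lerDl.
by apply: sumr_ge0 => j _; exact: sqr_ge0.
Qed.

End cube.

(** * Invariance of Lebesgue measure under orthogonal matrices *)

Section orthogonal_invariance.
Variables (R : realType) (n : nat).
Local Notation vec := 'cV[R]_n.
Local Notation leb := (lebesgue_cv R n).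

Lemma measurable_preimage_mulmx (g : 'M[R]_n) (A : set vec) :
  measurable A -> measurable ((fun x : vec => g *m x) @^-1` A).
Proof.
have mg : measurable_fun setT (fun x : vec => g *m x) by exact: measurable_mulmx.
by move=> mA; rewrite -[X in measurable X]setTI; exact: mg.
Qed.

(** Tonelli for sets: both orders of slicing agree on rectangles, hence everywhere. *)
Lemma product_measure12 (S : set (vec * vec)) :
  measurable S -> (leb \x leb)%E S = (leb \x^ leb)%E S.
Proof.
by move=> mS; apply: product_measure_unique => // *; exact: product_measure2E.
Qed.

(** The section measure is [k] on [A] and 0 off [A], where sections are empty, so it integrates to
    [leb A * k]. *)
Lemma product_measure1_section (A : set vec) (S : set (vec * vec)) (k : \bar R) :
  (0 <= k)%E -> measurable A ->
  (forall x, A x -> leb (xsection S x) = k) ->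
  (forall p, S p -> A p.1) ->
  (leb \x leb)%E S = (leb A * k)%E.
Proof.
move=> k0 mA Sk SA; rewrite /product_measure1.
rewrite (eq_integral (fun x => (\1_A x)%:E * k)%E) => [|x _].
  rewrite ge0_integralZr ?integral_indic ?setIT //.
  exact: measurableT_comp.
rewrite indicE /=; case: (boolP (x \in A)) => [/set_mem/Sk ->|Ax].
  by rewrite mul1e.
rewrite (_ : xsection S x = set0) ?measure0 ?mul0e //.
by apply/seteqP; split => // y /xsectionP /SA /= /mem_set; rewrite (negbTE Ax).
Qed.

(* Uniqueness of translation-invariant measures, specialised to the pair [leb]
   and its image under [g], with both factors translated inside one product. *)
Lemma lebesgue_cv_orthogonal_mul (g : 'M[R]_n) (A B : set vec) :
  g^T *m g = 1%:M -> measurable A -> measurable B ->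
  (fun x : vec => g *m x) @^-1` B = B ->
  (leb A * leb B = leb B * leb ((fun x : vec => - g *m x) @^-1` A))%E.
Proof.
move=> gg mA mB gB; have gg' := mulmx1C gg.
(* Slicing at fixed first coordinate gives one side of the claim from [S] and the other from [S'].
   At fixed second coordinate [y] the slices are [A] meeting [B - g y], and [B] meeting [A + g y],
   which are translates of each other. *)
pose S : set (vec * vec) := [set p | A p.1 /\ B (g *m p.2 + p.1)].
pose S' : set (vec * vec) := [set p | B p.1 /\ A (- g *m p.2 + p.1)].
have mpre (h : 'M[R]_n) (C D : set vec) : measurable C -> measurable D ->
    measurable [set p : vec * vec | C p.1 /\ D (h *m p.2 + p.1)].
  move=> mC mD.
  have mh : measurable_fun setT (fun p : vec * vec => h *m p.2 + p.1).
    by apply: measurable_addmx => //; exact: measurable_mulmx.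
  have mf : measurable_fun setT (@fst vec vec) by exact: measurable_fst.
  have /= mC' := mf measurableT _ mC; have /= mD' := mh measurableT _ mD.
  by rewrite !setTI in mC' mD'; exact: measurableI mC' mD'.
have mS : measurable S by exact: mpre.
have mS' : measurable S' by exact: mpre.
transitivity ((leb \x leb)%E S).
  symmetry; apply: product_measure1_section => // [x Ax|p []//].
  (* As [g g^T = 1], the condition [g y + x] in [B] reads [g (y + g^T x)] in [B]: the section is a
     translate of the preimage of [B], which is [B] itself. *)
  rewrite -[in RHS]gB -[RHS](lebesgue_cv_translation (g^T *m x)); last first.
    exact: measurable_preimage_mulmx.
  congr (leb _); apply/seteqP; split => y.
    by move=> /xsectionP[_] /=; rewrite mulmxDr mulmxA gg' mul1mx.
  by rewrite /= mulmxDr mulmxA gg' mul1mx => By; apply/xsectionP.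
transitivity ((leb \x leb)%E S'); last first.
  apply: product_measure1_section => // [x Bx|p []//].
  rewrite -[RHS](lebesgue_cv_translation (- g^T *m x)); last first.
    exact: measurable_preimage_mulmx.
  have E y : - g *m (y + - g^T *m x) = - g *m y + x.
    by rewrite mulmxDr !mulNmx mulmxN opprK mulmxA gg' mul1mx.
  congr (leb _); apply/seteqP; split => y.
    by move=> /xsectionP[_] /=; rewrite E.
  by rewrite /= E => Ay; apply/xsectionP.
(* The order of slicing is swapped here; translation by [g *m y] then matches the two slices. *)
rewrite !product_measure12 //; apply: eq_integral => y _ /=.
rewrite -[RHS](lebesgue_cv_translation (g *m y)); last exact: measurable_ysection.
congr (leb _); apply/seteqP; split => x.
  move=> /ysectionP[/= Ax Bx]; apply/ysectionP; rewrite /S' /=.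
  by rewrite mulNmx addrCA addNr addr0 [x + _]addrC.
move=> /ysectionP; rewrite /S' /= mulNmx addrCA addNr addr0 => -[Bx Ax].
by apply/ysectionP; rewrite /S /= addrC.
Qed.

Lemma lebesgue_cv_orthogonal (g : 'M[R]_n) (A : set vec) :
  g^T *m g = 1%:M -> measurable A ->
  leb ((fun x : vec => g *m x) @^-1` A) = leb A.
Proof.
move=> gg mA.
(* The preceding identity involves the preimage under minus its matrix, so it is applied to [- g],
   which is also orthogonal and preserves the ball. *)
have Ngg : (- g)^T *m - g = 1%:M by rewrite mulmxN [(- g)^T]raddfN mulNmx opprK.
have gB : (fun x : vec => - g *m x) @^-1` @unit_ball R n = @unit_ball R n.
  apply/funext => x; rewrite /preimage /unit_ball /=.
  by rewrite trmx_mul -mulmxA (mulmxA _^T _ x) Ngg mul1mx.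
have := lebesgue_cv_orthogonal_mul Ngg mA (@measurable_unit_ball R n) gB.
rewrite opprK muleC => /esym.
have /andP[B0 Boo] := lebesgue_cv_unit_ball R n.
have Bfin : leb (@unit_ball R n) \is a fin_num by rewrite gt0_fin_numE.
(* Cancelling the measure of the ball is legitimate because it is positive and finite. *)
by move/eqP; rewrite eq_le !lee_pmul2l // -eq_le => /eqP.
Qed.

End orthogonal_invariance.

(** * Clifford-valued integrals and rotation covariance *)

Lemma cl_integral_orthogonal (R : realType) (n : nat) (F : 'cV[R]_n -> Cl R n)
    (g : 'M[R]_n) : g^T *m g = 1%:M ->
  cl_integral (lebesgue_cv R n) setT (fun x => F (g *m x)) =
  cl_integral (lebesgue_cv R n) setT F.
Proof.
move=> gg; rewrite /cl_integral; apply: eq_ffun => A; congr fine.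
apply: (@integral_comp_bijection _ _ _ (lebesgue_cv R n)
  (fun x => g *m x) (fun x => g^T *m x) (fun x => (F x A)%:E)).
- by move=> x; rewrite mulmxA (mulmx1C gg) mul1mx.
- exact: measurable_mulmx.
- exact: measurable_mulmx.
- by move=> B mB; exact: lebesgue_cv_orthogonal.
- move=> B mB; apply: lebesgue_cv_orthogonal => //.
  by rewrite trmxK; exact: mulmx1C.
Qed.

Theorem mainTheorem8 (R : realType) (n : nat)
    (hn : (n %% 4 = 2 \/ n %% 4 = 3)%N)
    (haar : probability 'M[R]_n R) (hhaar : is_haar_SO haar)
    (psi f : 'cV[R]_n -> Cl R n)
    (hpsi : admissible haar psi) (hf : is_L2 f)
    (r r0 r' : 'M[R]_n) (hr : SO r) (hr0 : SO r0) (hr' : r' = r0 *m r)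
    (a : R) (ha : 0 < a) (b : 'cV[R]_n) :
  wavelet_transform psi (fun x => f (r0 *m x)) a r b =
  wavelet_transform psi f a r' (r0 *m b).
Proof.
have [rr _] := hr; have [r0r0 _] := hr0.
have invmx_r : invmx r = r^T.
  by rewrite -[LHS]mul1mx -rr mulmxK //; case/mulmx1_unit: rr.
have invmx_r' : invmx r' = r^T *m r0^T.
  have r'r' : r^T *m r0^T *m r' = 1%:M.
    by rewrite hr' mulmxA -(mulmxA _ _ r0) r0r0 mulmx1.
  by rewrite -[LHS]mul1mx -r'r' mulmxK //; case/mulmx1_unit: r'r'.
(* The inverse of [r'] is [r^T *m r0^T], and its factor [r0^T] cancels the [r0] pulled out of
   [r0 *m x - r0 *m b]. The whole integrand thus becomes a function of [r0 *m x]. *)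
have daughter_rot x : daughter psi a r b x = daughter psi a r' (r0 *m b) (r0 *m x).
  rewrite /daughter invmx_r invmx_r' -mulmxBr -mulmxA -!scalemxAr.
  by rewrite (mulmxA r0^T) r0r0 mul1mx.
rewrite /wavelet_transform; under eq_fun do rewrite daughter_rot.
exact: (cl_integral_orthogonal
  (fun x => f x * cl_rev (daughter psi a r' (r0 *m b) x)) r0r0).
Qed.
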